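(* Let $X$ be a nonempty Tychonoff space. The following are equivalent. (a) One has a winning strategy in $G_1(\mathcal N[K(X)],\neg\mathcal K_X)$. (b) One has a winning strategy in $G_1(\mathcal N_{\mathbf 0},\neg\Gamma_{C_k(X),\mathbf 0})$. (c) One has a winning strategy in $G_1(\mathcal N_{\mathbf 0},\neg\Omega_{C_k(X),\mathbf 0})$. (d) One has a winning strategy in $G_1(\mathcal T_{C_k(X)},CD_{C_k(X)})$. (e) Two has a winning strategy in $G_1(\mathcal K_X,\mathcal K_X)$. (f) Two has a winning strategy in $G_1(\Omega_{C_k(X),\mathbf 0},\Omega_{C_k(X),\mathbf 0})$. (g) Two has a winning strategy in $G_1(\mathcal D_{C_k(X)},\Omega_{C_k(X),\mathbf 0})$.
   Context: Spaces. $C_k(X)$ is the set of continuous functions $X\to\mathbb R$ with the topology of uniform convergence on compact subsets of $X$ (the compact-open topology); $\mathbf 0$ is the zero function. $K(X)$ is the family of nonempty compact subsets of $X$. Covers. An open cover of $X$ is a collection $\mathcal U$ of open sets with $\bigcup\mathcal U=X$ and $X\notin\mathcal U$ (all open covers are nontrivial). A $k$-cover is an open cover $\mathcal U$ such that every compact $K\subseteq X$ is contained in some $U\in\mathcal U$. $\mathcal K_X$ is the collection of all $k$-covers of $X$. For $A\subseteq X$, $\mathcal N(A)$ is the set of open $U\subsetneq X$ with $A\subseteq U$, and $\mathcal N[K(X)]=\{\mathcal N(K):K\in K(X)\}$; so in a game with first argument $\mathcal N[K(X)]$ One plays a compact set $K$ and Two answers with an open set $U\supseteq K$, $U\ne X$.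 Families in a space $Y$ with $y\in Y$. $\mathcal T_Y$: nonempty open subsets of $Y$. $\mathcal D_Y$: dense subsets of $Y$. $CD_Y$: closed and discrete subsets of $Y$. $\Omega_{Y,y}$: sets $A\subseteq Y$ with $y\in\overline{A}$. $\Gamma_{Y,y}$: sequences in $Y$ converging to $y$. $\mathcal N_{\mathbf 0}$: all open neighborhoods of $\mathbf 0$ in $C_k(X)$. Games. In $G_1(\mathcal A,\mathcal B)$, in each round $n\in\omega$ One plays $A_n\in\mathcal A$ and Two answers with $B_n\in A_n$; Two wins if $\{B_n:n\in\omega\}\in\mathcal B$, otherwise One wins. In $G_1(\mathcal A,\neg\mathcal B)$ Two wins if $\{B_n:n\in\omega\}\notin\mathcal B$, otherwise One wins (for $\mathcal B=\Gamma_{Y,y}$, membership means that the sequence $(B_n)_{n\in\omega}$ converges to $y$). A player who has no legal move loses. Strategies here are of perfect information (each move may depend on the whole history of play); a strategy is winning if its owner wins every play in which it is followed. *)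

(* Defs.v *)
From HB Require Import structures.
From mathcomp Require Import all_boot all_order all_algebra.
From mathcomp Require Import all_classical all_reals all_analysis.

Set Implicit Arguments.
Unset Strict Implicit.
Unset Printing Implicit Defensive.

Import Order.TTheory GRing.Theory Num.Theory.
Import numFieldNormedType.Exports.

Local Open Scope classical_set_scope.
Local Open Scope ring_scope.

(** A game in which, in round [n], One plays a set [a n] in [one_moves] and Two
    answers with an element [b n] of [a n]; [two_wins] is the set of sequences
    of answers that are wins for Two.  The winner depends on the answers only. *)
Record game (M : Type) := Game {
  one_moves : set (set M);
  two_wins : set (nat -> M)
}.

Section games.
Context {M : Type}.
Implicit Types (G : game M) (A B : set (set M)) (W : set (nat -> M)).

(** [G1 A (by_range B)] is the game G_1(A, B), and [G1 A (~` by_range B)] is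
    G_1(A, not B).  A condition on sequences rather than on their sets of terms,
    such as convergence, is used directly as the second argument. *)
Definition by_range B : set (nat -> M) := [set b | B (range b)].

Definition G1 A W : game M := Game A W.

(** The first [n] rounds of a play, in chronological order. *)
Definition history (a : nat -> set M) (b : nat -> M) (n : nat) :
    seq (set M * M) :=
  [seq (a i, b i) | i <- iota 0 n].

Inductive reached_by_one (sigma : seq (set M * M) -> set M) :
    seq (set M * M) -> Prop :=
| one_start : reached_by_one sigma [::]
| one_round h b : reached_by_one sigma h -> sigma h b ->
    reached_by_one sigma (rcons h (sigma h, b)).

Inductive reached_by_two A (tau : seq (set M * M) -> set M -> M) :
    seq (set M * M) -> Prop :=
| two_start : reached_by_two A tau [::]
| two_round h a : reached_by_two A tau h -> A a ->
    reached_by_two A tau (rcons h (a, tau h a)).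

(** A winning strategy must provide a legal move at every position that can be
    reached by following it, so its owner is never stuck; a play in which the
    opponent is stuck is finite and is won without further condition. *)
Definition One_has_winning_strategy G :=
  exists sigma : seq (set M * M) -> set M,
    (forall h, reached_by_one sigma h -> one_moves G (sigma h)) /\
    (forall (a : nat -> set M) (b : nat -> M),
      (forall n, a n = sigma (history a b n) /\ a n (b n)) ->
      ~ two_wins G b).

(** Strategies of Two are total functions into [M], which is harmless as long
    as [M] is inhabited. *)
Definition Two_has_winning_strategy G :=
  exists tau : seq (set M * M) -> set M -> M,
    (forall h a, reached_by_two (one_moves G) tau h -> one_moves G a ->
      a (tau h a)) /\
    (forall (a : nat -> set M) (b : nat -> M),
      (forall n, one_moves G (a n) /\ b n = tau (history a b n) (a n)) ->
      two_wins G b).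

End games.

Definition tychonoff_space (X : topologicalType) :=
  hausdorff_space X /\ completely_regular_space X.

Section covers.
Context (X : topologicalType).

Definition open_cover (U : set (set X)) :=
  [/\ U `<=` open, \bigcup_(V in U) V = [set: X] & ~ U [set: X]].

Definition k_covers : set (set (set X)) :=
  [set U | open_cover U /\
           forall K : set X, compact K -> exists2 V, U V & K `<=` V].

Definition compacts : set (set X) := [set K | K !=set0 /\ compact K].

Definition proper_open_supersets (A : set X) : set (set X) :=
  [set U | [/\ open U, U <> [set: X] & A `<=` U]].

Definition compact_moves : set (set (set X)) :=
  [set proper_open_supersets K | K in compacts].

End covers.

Arguments k_covers : clear implicits.
Arguments compacts : clear implicits.
Arguments compact_moves : clear implicits.

Section families.
Context (Y : topologicalType).

Definition nonempty_opens : set (set Y) := [set U | open U /\ U !=set0].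

Definition dense_sets : set (set Y) := [set D | dense D].

Definition closed_discrete_sets : set (set Y) :=
  [set D | closed D /\ D `<=` isolated D].

Definition clustering_at (y : Y) : set (set Y) := [set A | closure A y].

Definition converging_to (y : Y) : set (nat -> Y) := [set u | u @ \oo --> y].

End families.

Arguments nonempty_opens : clear implicits.
Arguments dense_sets : clear implicits.
Arguments closed_discrete_sets : clear implicits.

(** The topology is the one induced by [{family compact, X -> R}], the topology
    of uniform convergence on compact sets on all functions. *)
Definition Ck (X : topologicalType) (R : realType) : Type := continuousType X R.

HB.instance Definition _ (X : topologicalType) (R : realType) :=
  Choice.copy (Ck X R) (continuousType X R).

Definition Ck_fun (X : topologicalType) (R : realType) (f : Ck X R) :
    {family compact, X -> R} :=
  Continuous.sort f.

HB.instance Definition _ (X : topologicalType) (R : realType) :=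
  Topological.copy (Ck X R) (initial_topology (@Ck_fun X R)).

Definition Ck0 (X : topologicalType) (R : realType) : Ck X R :=
  cst (0 : R) : continuousType X R.

(* Main.v *)
Require Import Defs.
From mathcomp Require Import all_boot all_order all_algebra.
From mathcomp Require Import all_classical all_reals all_analysis.
From mathcomp Require Import lra.

Import Order.TTheory GRing.Theory Num.Theory.
Import numFieldNormedType.Exports.

Local Open Scope classical_set_scope.
Local Open Scope ring_scope.

(** Two mechanisms prove the equivalence of the seven conditions.

    Duality ([G1_dual]).  Let every set of [A] meet every set of [B], and let
    every set of answers that meets all of [B] belong to [A].  Then One wins
    G_1(B, not W) if and only if Two wins G_1(A, W).  Given a strategy of
    One in the first game, Two answers in the second with a point of the set
    just played that is also in the next set played by this strategy.
    Conversely, given a strategy of Two, at every position some set of [B] consists of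
    possible answers of this strategy: otherwise choose in each set of [B] a
    point that is never an answer; these points form a set of [A], and the
    answer to that set is one of them.  One plays this set of [B].  A family of
    proper open sets is a k-cover if and only if it meets the family of proper
    open supersets of every compact set; a set clusters at [y] if and only if it
    meets every open neighbourhood of [y], and is dense if and only if it meets
    every nonempty open set.  This gives (a) <-> (e), (c) <-> (f) and
    (g) <-> (g'), where (g') says that One has a winning strategy in the game
    G_1(T, not Omega_0) on the family T of nonempty open sets of C_k(X).

    Translation ([One_wins_G1_transfer]): a winning strategy of One in one game
    is used in another by turning its moves, and the answers to them, into moves
    and answers of the other game.
    - (a) -> (b): If One plays at each turn the intersection of what the given
      strategy would play against all subsequences of the answers so far, then
      every subsequence of the answers is a k-cover ([One_wins_subsequences]);
      so every compact set is contained in all but finitely many answers.  When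
      this strategy plays a compact set K_n, the move in C_k(X) consists of the
      functions of absolute value less than 1/(n+1) on K_n, and an answer f_n
      is turned into the set where |f_n| < 1/(n+1), if this is not all of X.
    - (b) -> (c): the limit of a sequence is in the closure of its range.
    - (c) -> (d): One removes 0 from each neighbourhood; then 0 is in the
      closure of the set of answers but not in the set.
    - (c) -> (g'): an open neighbourhood of 0 is a nonempty open set.
    - (d) -> (a) and (g') -> (a): a nonempty open set contains all functions
      that agree with a certain f on a certain compact set K.  One plays K, and
      an answer U is turned into a function that agrees with f on K and is equal
      to n+1 off U ([compact_closed_separation]).  If the answers do not form a
      k-cover, some compact set L is contained in none of them.  Then the n-th
      function takes the value n+1 at some point of L, and the range of a
      sequence of such functions is closed and discrete, and 0 is not in its
      closure. *)

(** * Strategies in a selection game *)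

Lemma mkseqSr (T : Type) (f : nat -> T) n :
  mkseq f n.+1 = rcons (mkseq f n) (f n).
Proof. by rewrite /mkseq -addn1 iotaD map_cat add0n cats1. Qed.

Lemma foldl_mkseqS (S T : Type) (f : S -> T -> S) z (b : nat -> T) n :
  foldl f z (mkseq b n.+1) = f (foldl f z (mkseq b n)) (b n).
Proof. by rewrite mkseqSr foldl_rcons. Qed.

Lemma historyS (M : Type) (a : nat -> set M) (b : nat -> M) n :
  history a b n.+1 = rcons (history a b n) (a n, b n).
Proof. exact: mkseqSr. Qed.

(** A position reached by following a strategy is determined by the answers of
    Two, so a strategy may depend on those alone.  As it has a legal first move,
    it can also be made legal at the positions that are never reached. *)
Lemma One_has_winning_strategyP (M : Type) (A : set (set M))
    (W : set (nat -> M)) :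
  One_has_winning_strategy (G1 A W) <->
  exists s : seq M -> set M, (forall l, A (s l)) /\
    forall b, (forall n, s (mkseq b n) (b n)) -> ~ W b.
Proof.
split=> [[sigma [legal win]]|[s [legal win]]]; last first.
  exists (fun h => s (unzip2 h)); split=> [h _|a b ab]; first exact: legal.
  apply: win => n; have [an] := ab n; rewrite an.
  by rewrite /history /unzip2 -map_comp.
(* the position in which [sigma] has been answered with a given sequence *)
pose pos := foldl (fun h b => rcons h (sigma h, b)) [::].
pose s l := if `[< A (sigma (pos l)) >] then sigma (pos l) else sigma [::].
exists s; split=> [l|b sb].
  rewrite /s; case: asboolP => // _.
  exact/legal/one_start.
have sE l : reached_by_one sigma (pos l) -> s l = sigma (pos l).
  by move=> /legal ?; rewrite /s asboolT.
have reach n : reached_by_one sigma (pos (mkseq b n)).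
  elim: n => [|n IH]; first exact: one_start.
  rewrite /pos foldl_mkseqS; apply: one_round => //.
  by rewrite -sE.
apply: (win (fun n => s (mkseq b n))) => n; split=> //.
rewrite sE//; congr sigma; elim: n => // n IH.
by rewrite historyS -IH /pos foldl_mkseqS -/pos sE.
Qed.

(** The analogue for Two: at a position that is not reached, the answer is the
    one that the strategy gives in the first round. *)
Lemma Two_has_winning_strategyP (M : Type) (A : set (set M))
    (W : set (nat -> M)) :
  Two_has_winning_strategy (G1 A W) <->
  exists t : seq (set M) -> set M -> M, (forall l a, A a -> a (t l a)) /\
    forall a, (forall n, A (a n)) -> W (fun n => t (mkseq a n) (a n)).
Proof.
split=> [[tau [legal win]]|[t [legal win]]]; last first.
  exists (fun h => t (unzip1 h)); split=> [h a _|a b ab]; first exact: legal.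
  suff -> : b = (fun n => t (mkseq a n) (a n)) by apply: win => n; case: (ab n).
  apply/funext => n; have [_ ->] := ab n.
  by rewrite /history /unzip1 -map_comp.
pose pos := foldl (fun h a => rcons h (a, tau h a)) [::].
pose t l a := if `[< a (tau (pos l) a) >] then tau (pos l) a else tau [::] a.
exists t; split=> [l a Aa|a Aa].
  by rewrite /t; case: asboolP => // _; exact: legal (two_start _ _) Aa.
have reach n : reached_by_two A tau (pos (mkseq a n)).
  elim: n => [|n IH]; first exact: two_start.
  by rewrite /pos foldl_mkseqS; exact: two_round.
have tE n : t (mkseq a n) (a n) = tau (pos (mkseq a n)) (a n).
  by rewrite /t asboolT//; exact: legal (reach n) (Aa n).
apply: (win a) => n; split=> //.
rewrite tE; congr tau; elim: n => // n IH.
by rewrite historyS -IH tE /pos foldl_mkseqS.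
Qed.

(** One follows the given strategy in a simulated play of the first game: its
    move [a] in round [n] is replaced by [move n a] in the second game, and an
    answer [b] to the latter becomes the answer [resp n a b] to [a]. *)
Lemma One_wins_G1_transfer (M M' : Type) (A : set (set M)) (A' : set (set M'))
    (W : set (nat -> M)) (W' : set (nat -> M'))
    (move : nat -> set M -> set M') (resp : nat -> set M -> M' -> M) :
  (forall n a, A a -> A' (move n a)) ->
  (forall n a b, A a -> move n a b -> a (resp n a b)) ->
  (forall a b, (forall n, A (a n) /\ move n (a n) (b n)) -> W' b ->
    W (fun n => resp n (a n) (b n))) ->
  One_has_winning_strategy (G1 A W) -> One_has_winning_strategy (G1 A' W').
Proof.
move=> Amove aresp WW' /One_has_winning_strategyP[s [legal win]].
apply/One_has_winning_strategyP.
pose pos := foldl (fun l b => rcons l (resp (size l) (s l) b)) [::].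
exists (fun l => move (size l) (s (pos l))); split=> [l|b sb W'b].
  exact/Amove/legal.
pose c n := resp n (s (pos (mkseq b n))) (b n).
have posE n : pos (mkseq b n) = mkseq c n.
  elim: n => // n IH.
  by rewrite /pos foldl_mkseqS -/pos mkseqSr {1 2}IH size_mkseq /c -IH.
apply: (win c) => [n|].
  rewrite -posE /c; apply: aresp => //.
  by have := sb n; rewrite size_mkseq.
apply: WW' W'b => n; split; first exact: legal.
by have := sb n; rewrite size_mkseq.
Qed.

Lemma mask_mkseq (T : Type) (b : nat -> T) (phi : nat -> nat) (n : nat) :
  {homo phi : i j / (i < j)%N} ->
  exists m, mkseq (b \o phi) n = mask m (mkseq b (phi n)).
Proof.
move=> phi_lt.
have /subseqP[m _ mE] : subseq (mkseq phi n) (iota 0 (phi n)).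
  have <- : [seq i <- iota 0 (phi n) | i \in mkseq phi n] = mkseq phi n.
    apply: (irr_sorted_eq ltn_trans ltnn) => [||i].
    - exact: sorted_filter ltn_trans _ _ (iota_ltn_sorted 0 _).
    - exact: homo_sorted phi_lt _ (iota_ltn_sorted 0 n).
    - rewrite mem_filter mem_iota andb_idr// => /mapP[j].
      by rewrite mem_iota => /andP[_ jn] ->; exact: phi_lt.
  exact: filter_subseq.
by exists m; rewrite {2}/mkseq -map_mask -mE -map_comp.
Qed.

(** One plays the intersection of the moves of the given strategy against all
    subsequences of the answers so far.  Then every subsequence of the answers
    is a sequence of answers to the original strategy. *)
Lemma One_wins_subsequences (M : Type) (A : set (set M)) (W : set (nat -> M)) :
  (forall a a', A a -> A a' -> A (a `&` a')) ->
  One_has_winning_strategy (G1 A W) ->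
  One_has_winning_strategy (G1 A [set b : nat -> M | exists2 phi : nat -> nat,
    {homo phi : i j / (i < j)%N} & W (b \o phi)]).
Proof.
move=> AI /One_has_winning_strategyP[s [legal win]].
apply/One_has_winning_strategyP.
(* the intersection of the values of [f] on the subsequences of [l] *)
pose fix meet (f : seq M -> set M) l := if l is x :: l'
  then meet f l' `&` meet (fun k => f (x :: k)) l' else f [::].
have meetA l f : (forall k, A (f k)) -> A (meet f l).
  by elim: l f => //= x l IH f Af; apply: AI; apply: IH.
have meetP l f m : meet f l `<=` f (mask m l).
  elim: l f m => [|x l IH] f m; first by rewrite mask0.
  move=> y /= [y1 y2]; case: m => [|[] m] /=.
  - exact: (IH f [::]).
  - exact: IH (fun k => f (x :: k)) m y y2.
  - exact: IH.
exists (meet s); split=> [l|b sb [phi phi_lt]]; first exact: meetA.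
apply: win => n /=; have [m ->] := mask_mkseq M b phi n phi_lt.
exact: meetP (sb (phi n)).
Qed.

(** Under these hypotheses [B] is what is called a reflection of [A]: the sets
    obtained by choosing one point in each set of [B] are members of [A], and
    each member of [A] contains such a set. *)
Lemma G1_dual (M : Type) (m0 : M) (A B : set (set M)) (W : set (nat -> M)) :
  (forall a b, A a -> B b -> a `&` b !=set0) ->
  (forall S, S `<=` \bigcup_(b in B) b -> (forall b, B b -> S `&` b !=set0) ->
    A S) ->
  One_has_winning_strategy (G1 B (~` W)) <-> Two_has_winning_strategy (G1 A W).
Proof.
move=> AB BA; split.
- move=> /One_has_winning_strategyP[s [legal win]].
  apply/Two_has_winning_strategyP.
  have /choice[pick pickP] (al : set M * seq M) :
      exists y, A al.1 -> (al.1 `&` s al.2) y.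
    have [Aa|] := pselect (A al.1); last by exists m0.
    by have [y ay] := AB _ _ Aa (legal al.2); exists y.
  pose pos := foldl (fun l a => rcons l (pick (a, l))) [::].
  exists (fun l a => pick (a, pos l)).
  split=> [l a /(pickP (a, pos l))[]//|a Aa].
  set b := (fun n : nat => _).
  have posE n : pos (mkseq a n) = mkseq b n.
    elim: n => // n IH.
    by rewrite /pos foldl_mkseqS -/pos mkseqSr {1}IH.
  apply: contrapT; apply: (win b) => n.
  by rewrite -posE; have [] := pickP (a n, pos (mkseq a n)) (Aa n).
- move=> /Two_has_winning_strategyP[t [legal win]].
  apply/One_has_winning_strategyP.
  (* some set of [B] contains only answers of [t] at this position *)
  have /choice[r rP] (l : seq (set M)) : exists b, B b /\
      forall y, b y -> exists2 a, A a & t l a = y.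
    apply: contrapT => noB.
    have /choice[f fP] (b : set M) : exists y, B b ->
        b y /\ forall a, A a -> t l a <> y.
      have [Bb|] := pselect (B b); last by exists m0.
      have [y [by_ ty]] : exists y, b y /\ forall a, A a -> t l a <> y.
        apply: contrapT => noy; apply: noB; exists b; split=> // y by_.
        apply: contrapT => noa; apply: noy; exists y; split=> // a Aa tay.
        by apply: noa; exists a.
      by exists y.
    (* no point of [f @` B] is an answer, but [t] must answer [f @` B] *)
    have AfB : A (f @` B).
      apply: BA => [_ [b Bb <-]|b Bb].
        by exists b => //; have [] := fP _ Bb.
      by exists (f b); split; [exists b | have [] := fP _ Bb].
    have [b Bb] := legal l _ AfB.
    by have [_ /(_ _ AfB)+ ft] := fP _ Bb; rewrite ft.
  have /choice[g gP] (ly : seq (set M) * M) :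
      exists a, r ly.1 ly.2 -> A a /\ t ly.1 a = ly.2.
    have [ry|] := pselect (r ly.1 ly.2); last by exists set0.
    by have [a Aa ta] := (rP ly.1).2 _ ry; exists a.
  (* [g (l, y)] is a move of One after [l] that [t] answers with [y] *)
  pose pos := foldl (fun l y => rcons l (g (l, y))) [::].
  exists (r \o pos); split=> [l|b rb]; first by have [] := rP (pos l).
  pose a n := g (pos (mkseq b n), b n).
  have posE n : pos (mkseq b n) = mkseq a n.
    elim: n => // n IH.
    by rewrite /pos foldl_mkseqS -/pos mkseqSr {1}IH.
  have aP n : A (a n) /\ t (mkseq a n) (a n) = b n.
    by rewrite -posE; exact: gP (pos (mkseq b n), b n) (rb n).
  have -> : b = (fun n => t (mkseq a n) (a n)).
    by apply/funext => n; have [] := aP n.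
  by apply; apply: win => n; have [] := aP n.
Qed.

(** * Compact sets and functions in a completely regular space *)

(** Otherwise the complements in [K] of the sets satisfying [P] generate a
    proper filter on [K]; no neighbourhood of a cluster point satisfies [P]. *)
Lemma compact_of_local (X : topologicalType) (P : set (set X)) (K : set X) :
  P set0 -> (forall A B, P A -> P B -> P (A `|` B)) ->
  (forall A B, A `<=` B -> P B -> P A) ->
  (forall x, K x -> exists2 A, P A & nbhs x A) -> compact K -> P K.
Proof.
move=> P0 PU PS Ploc cK; apply: contrapT => nPK.
pose F := filter_from P (fun A => K `\` A).
have FF : Filter F.
  apply: filter_from_filter; first by exists set0.
  move=> A B PA PB; exists (A `|` B); first exact: PU.
  by rewrite setDUr.
have PF : ProperFilter F.
  apply: filter_from_proper => A PA; apply/set0P/negP => /eqP KA0.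
  apply: nPK; apply: (PS _ A) => // x Kx; apply: contrapT => nAx.
  by have : (K `\` A) x by []; rewrite KA0.
have [] := cK F PF; first by exists set0 => // x [].
move=> x [Kx clx]; have [A PA nA] := Ploc x Kx.
have FA : F (K `\` A) by exists A.
by have [y [[_ ?] ?]] := clx _ _ FA nA.
Qed.

(** The subsets of [X] on which some nonnegative continuous function vanishing
    off [U] is at least 1 are closed under unions, by addition.  Complete
    regularity provides such functions near each point of [U]; the minimum of 1
    and a function obtained for [K] has the required values. *)
Lemma compact_closed_separation (R : realType) (X : topologicalType)
    (K U : set X) :
  completely_regular_space X -> compact K -> open U -> K `<=` U ->
  exists h : X -> R, [/\ continuous h, forall x, K x -> h x = 1 &
    forall x, ~ U x -> h x = 0].
Proof.
move=> crX cK oU KU.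
pose P : set (set X) := [set A | exists h : X -> R,
  [/\ continuous h, forall x, 0 <= h x, forall x, A x -> 1 <= h x &
      forall x, ~ U x -> h x = 0]].
suff [h [ch h0 h1 hU]] : P K.
  exists (h \min cst 1); split=> [x|x Kx|x Ux] /=.
  - apply: continuous_min; [exact: ch | exact: cst_continuous].
  - by apply/min_idPr/h1.
  - by rewrite hU//; apply/min_idPl.
apply: compact_of_local => //.
- exists (cst 0); split=> // x; exact: cst_continuous.
- move=> A B [f [cf f0 f1 fU]] [g [cg g0 g1 gU]].
  exists (f \+ g); split=> [x|x|x|x Ux] /=.
  + by apply: cvgD; [exact: cf | exact: cg].
  + by rewrite addr_ge0.
  + by case=> [/f1|/g1]; [have := g0 x | have := f0 x]; lra.
  + by rewrite fU// gU// addr0.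
- move=> A B AB [h [ch h0 h1 hU]]; exists h; split=> // x /AB; exact: h1.
- move=> x Kx.
  have /uniform_separatorP : uniform_separator [set x] (~` U).
    by apply: crX; [exact: open_closedC | move=> /(_ (KU x Kx))].
  move=> /(_ R)[f [cf f01 fx fU]].
  have {}f01 y : 0 <= f y <= 1.
    by have := f01 (f y); rewrite /= in_itv; apply; exists y.
  have {}fx : f x = 0 by apply: fx; exists x.
  exists [set y | f y < 2^-1]; last first.
    have := @cvgr_lt R X (nbhs x) _ f (f x) (cf x); apply.
    by rewrite fx invr_gt0.
  (* [f] is 0 at [x] and 1 off [U]; where f < 1/2, 2(1 - f) exceeds 1 *)
  exists (fun y => (1 - f y) * 2); split=> [y|y|y|y Uy] /=.
  + apply: cvgM; last exact: cvg_cst.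
    by apply: cvgB; [exact: cvg_cst | exact: cf].
  + by have := f01 y; lra.
  + by lra.
  + by have -> : f y = 1 by [apply: fU; exists y]; rewrite subrr mul0r.
Qed.

(** * The topology of uniform convergence on compact sets *)

Section Ck_balls.
Context {X : topologicalType} {R : realType}.
Implicit Types (f g : Ck X R) (K : set X) (e : R).

Definition Ck_ball f K e : set (Ck X R) :=
  [set g | forall x, K x -> `|f x - g x| < e].

Lemma nbhs_Ck_ball f K e : compact K -> 0 < e -> nbhs f (Ck_ball f K e).
Proof.
move=> cK e0.
have := @fam_nbhs X R compact K [set xy | ball xy.1 e xy.2] (Ck_fun f).
move=> /(_ (entourage_ball _ (PosNum e0)) cK).
exact: (@initial_continuous _ _ (@Ck_fun X R)).
Qed.

(** Any two balls contain a third, on the union of the compact sets, so the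
    balls around [f] generate a filter.  It converges to [f] uniformly on every
    compact set; hence it contains all neighbourhoods of [f]. *)
Lemma nbhs_CkP f (U : set (Ck X R)) : nbhs f U ->
  exists K e, [/\ compact K, 0 < e & Ck_ball f K e `<=` U].
Proof.
pose ball_on (Ke : set X * R) : set {family compact, X -> R} :=
  [set g | forall x, Ke.1 x -> `|f x - g x| < Ke.2].
pose F := filter_from [set Ke | compact Ke.1 /\ 0 < Ke.2] ball_on.
have FF : Filter F.
  apply: filter_from_filter.
    by exists (set0, 1); split=> //; exact: compact0.
  move=> [K e] [L d] [/= cK e0] [/= cL d0]; exists (K `|` L, Num.min e d).
    by split; [exact: compactU | rewrite /= lt_min e0].
  move=> g gKL; split=> x Kx /=; have /= := gKL x; rewrite lt_min.
    by move=> /(_ (or_introl Kx))/andP[].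
  by move=> /(_ (or_intror Kx))/andP[].
have Ff : {family compact, F --> (Ck_fun f : X -> R)}.
  apply/fam_cvgP => K cK V /uniform_nbhs[E [entE EV]].
  move: entE; rewrite -entourage_ballE => -[e /= e0 eE].
  exists (K, e) => // g ge; apply: EV => x Kx; apply: eE; exact: ge.
move=> [V [[W oW <-] Wf] VU].
have : nbhs (Ck_fun f) W by exact: open_nbhs_nbhs.
move=> /Ff [[K e] [cK e0] KeW].
by exists K, e; split=> // g gf; apply/VU/KeW.
Qed.

End Ck_balls.

Section Ck_facts.
Context (R : realType) (X : topologicalType).

Lemma open_Ck_neq (g : Ck X R) : open [set f : Ck X R | f <> g].
Proof.
rewrite openE => f fg.
have [x fx] : exists x, (f : X -> R) x <> (g : X -> R) x.
  apply: contrapT => fx; apply: fg; apply/continuousEP => x.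
  by apply: contrapT => fgx; apply: fx; exists x.
have fgx : 0 < `|(f : X -> R) x - (g : X -> R) x|.
  by rewrite normr_gt0 subr_eq0; exact/eqP.
apply: filterS (nbhs_Ck_ball f [set x] _ (@compact_set1 X x) fgx) => h fh hg.
by have := fh x erefl; rewrite hg ltxx.
Qed.

Lemma Ck0_not_isolated (U : set (Ck X R)) :
  [set: X] !=set0 -> nbhs (Ck0 X R) U -> exists2 f, U f & f <> Ck0 X R.
Proof.
move=> [x _] /nbhs_CkP[K [e [cK e0 KU]]].
exists (cst (e / 2) : continuousType X R).
  apply: KU => y _ /=.
  by rewrite sub0r normrN gtr0_norm ?divr_gt0// ltr_pdivrMr//; lra.
move=> /(congr1 (fun f : Ck X R => (f : X -> R) x)) /=; lra.
Qed.

(** Each function is bounded on [K], so its ball of radius 1 on [K] contains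
    only finitely many of the [f n]: the range is locally finite. *)
Lemma escaping_closed_discrete (K : set X) (f : nat -> Ck X R) : compact K ->
  (forall n, exists2 x, K x & (f n : X -> R) x = n.+1%:R) ->
  closed_discrete_sets (Ck X R) (range f).
Proof.
move=> cK fK.
suff sep g : exists2 V, nbhs g V & V `&` range f `<=` [set g].
  split=> [g clg|g [n _ fn]]; have [V Vg Vf] := sep g.
    have [h [Rh Vh]] := clg V Vg.
    by have <- : h = g by apply: Vf.
  split; first by apply/mem_set; exists n.
  exists V => //; apply/seteqP; split=> // _ ->; split; last by exists n.
  exact: nbhs_singleton.
have [N gN] : exists N : nat, forall x, K x -> (g : X -> R) x < N%:R.
  have /compact_bounded[M [_ gM]] : compact ((g : X -> R) @` K).
    apply: continuous_compact => //; apply: continuous_subspaceT.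
    exact: cts_fun.
  exists (Num.truncn (M + 1)).+1 => x Kx.
  apply: le_lt_trans (truncnS_gt (M + 1)).
  apply: le_trans (ler_norm _) _; apply: gM; last by exists x.
  by rewrite ltrDl.
have away m : nbhs g [set h | forall n, (n < m)%N -> h = f n -> h = g].
  elim: m => [|m IH]; first by apply: (filterS _ filterT) => h _ n.
  have [gfm|gfm] := pselect (g = f m).
  - apply: filterS IH => h IH n.
    by rewrite ltnS leq_eqVlt => /orP[/eqP->|/IH//]; rewrite -gfm.
  - have gm : nbhs g [set h | h <> f m].
      by apply: open_nbhs_nbhs; split=> //; exact: open_Ck_neq.
    apply: filterS2 gm IH => h hm IH n.
    by rewrite ltnS leq_eqVlt => /orP[/eqP->/hm//|/IH].
exists (Ck_ball g K 1 `&` [set h | forall n, (n < N)%N -> h = f n -> h = g]).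
  by apply: filterI => //; exact: nbhs_Ck_ball.
move=> h [[gh hN] [n _ fn]]; apply: (hN n) => //.
have [x Kx fx] := fK n.
have := gh x Kx; rewrite -fn fx -natr1 ltr_norml => /andP[+ _].
by have := gN x Kx; rewrite -(ltr_nat R); lra.
Qed.

Lemma escaping_not_clustering (K : set X) (f : nat -> Ck X R) : compact K ->
  (forall n, exists2 x, K x & (f n : X -> R) x = n.+1%:R) ->
  ~ closure (range f) (Ck0 X R).
Proof.
move=> cK fK /(_ _ (nbhs_Ck_ball _ K 1 cK ltr01))[_ [[n _ <-] f0]].
have [x Kx fx] := fK n; have := f0 x Kx.
by rewrite fx sub0r normrN normr_nat ltrn1.
Qed.

End Ck_facts.

(** * Dual games *)

Section k_covers.
Context (X : topologicalType).

Lemma k_coversI (S : set (set X)) : S `<=` open -> ~ S setT ->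
  (forall K, compact K -> exists2 V, S V & K `<=` V) -> k_covers X S.
Proof.
move=> So ST SK; split=> //; split=> //.
apply/seteqP; split=> // x _; have [V SV xV] := SK _ (@compact_set1 X x).
by exists V => //; exact: xV.
Qed.

Lemma compact_movesI (a b : set (set X)) :
  compact_moves X a -> compact_moves X b -> compact_moves X (a `&` b).
Proof.
move=> [K [[x Kx] cK] <-] [L [_ cL] <-].
exists (K `|` L); first by split; [exists x; left | exact: compactU].
apply/seteqP; split=> V.
  by move=> [oV VT KLV]; split; split=> // y ?; apply: KLV; [left|right].
by move=> [[oV VT KV] [_ _ LV]]; split=> // y [/KV|/LV].
Qed.

Lemma k_covers_dual : [set: X] !=set0 -> One_has_winning_strategy
    (G1 (compact_moves X) (~` by_range (k_covers X))) <->
  Two_has_winning_strategy (G1 (k_covers X) (by_range (k_covers X))).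
Proof.
move=> [x _].
apply: (G1_dual _ set0) => [a b [[ao _ aT] aK] [K [_ cK] <-]|S SB SK].
  have [V aV KV] := aK K cK; exists V; split=> //; split=> //; first exact: ao.
  by move=> VT; apply: aT; rewrite -VT.
have mem V : S V -> open V /\ V <> setT.
  by move=> /SB[_ [K _ <-] []].
apply: k_coversI => [V /mem[]//|/mem[]//|K cK].
(* [K] may be empty, and One plays nonempty compact sets: a point is added *)
have [|V [SV [_ _ KV]]] := SK (proper_open_supersets (K `|` [set x])).
  exists (K `|` [set x]) => //; split; first by exists x; right.
  by apply: compactU => //; exact: compact_set1.
by exists V => // y Ky; apply: KV; left.
Qed.

End k_covers.

Lemma clustering_dual (Y : topologicalType) (y : Y) (W : set (nat -> Y)) :
  One_has_winning_strategy (G1 (open_nbhs y) (~` W)) <->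
  Two_has_winning_strategy (G1 (clustering_at y) W).
Proof.
apply: (G1_dual _ y) => [a b ay [ob yb]|S _ Sb].
  by apply: ay; exact: open_nbhs_nbhs.
move=> V; rewrite nbhsE => -[b bo bV].
by have [z [Sz /bV]] := Sb _ bo; exists z.
Qed.

Lemma dense_dual (Y : topologicalType) (y : Y) (W : set (nat -> Y)) :
  One_has_winning_strategy (G1 (nonempty_opens Y) (~` W)) <->
  Two_has_winning_strategy (G1 (dense_sets Y) W).
Proof.
apply: (G1_dual _ y) => [a b da [ob b0]|S _ Sb].
  by rewrite setIC; exact: da.
by move=> O O0 oO; rewrite setIC; exact: Sb.
Qed.

(** * Strategies of One in related games *)

Lemma One_converging_clustering (Y : topologicalType) (y : Y) :
  One_has_winning_strategy (G1 (open_nbhs y) (~` converging_to y)) ->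
  One_has_winning_strategy (G1 (open_nbhs y) (~` by_range (clustering_at y))).
Proof.
apply: (One_wins_G1_transfer _ _ _ _ _ _ (fun _ U => U) (fun _ _ z => z)) => //.
move=> U b _; apply: contra_not => by_ V /by_[N _ bV].
by exists (b N); split; [exists N | exact: bV _ (leqnn N)].
Qed.

Lemma One_nbhs_opens (Y : topologicalType) (y : Y) (W : set (nat -> Y)) :
  One_has_winning_strategy (G1 (open_nbhs y) W) ->
  One_has_winning_strategy (G1 (nonempty_opens Y) W).
Proof.
apply: (One_wins_G1_transfer _ _ _ _ _ _ (fun _ U => U) (fun _ _ z => z)) => //.
by move=> _ U [oU Uy]; split=> //; exists y.
Qed.

(** The failures of a property that does not hold eventually can be enumerated
    increasingly. *)
Lemma eventually_of_subsequences (P : set nat) :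
  (forall phi : nat -> nat, {homo phi : i j / (i < j)%N} ->
    exists n, P (phi n)) ->
  \forall n \near \oo, P n.
Proof.
move=> sub; apply: contrapT => nP.
have /choice[g gP] N : exists n, (N <= n)%N /\ ~ P n.
  apply: contrapT => noN; apply: nP; exists N => // n /= Nn.
  by apply: contrapT => nPn; apply: noN; exists n.
pose phi := fix phi n := g (if n is m.+1 then (phi m).+1 else 0%N).
have nPphi n : ~ P (phi n).
  by case: n => [|n]; [have [] := gP 0%N | have [] := gP (phi n).+1].
have [|n] := sub phi; last exact: nPphi.
by apply: homo_ltn => [? ? ?|n]; [exact: ltn_trans | have [] := gP (phi n).+1].
Qed.

Section translations.
Context (R : realType) (X : topologicalType).

(** If [X] is compact, the sets of functions of absolute value less than
    1/(n+1) on the whole of [X] already force convergence.  Otherwise every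
    compact set has a proper open superset.  It replaces the set where
    |f_n| < 1/(n+1), as an answer, when the latter is all of [X] and hence
    not a legal answer; then |f_n| < 1/(n+1) everywhere, and nothing is lost. *)
Lemma One_k_cover_converging : hausdorff_space X ->
  One_has_winning_strategy (G1 (compact_moves X) (~` by_range (k_covers X))) ->
  One_has_winning_strategy
    (G1 (open_nbhs (Ck0 X R)) (~` converging_to (Ck0 X R))).
Proof.
move=> hX.
have ball_move K n : compact K ->
    open_nbhs (Ck0 X R) (Ck_ball (Ck0 X R) K n.+1%:R^-1)^°.
  move=> cK; split; first exact: open_interior.
  exact: nbhs_Ck_ball.
have invS_lt e : 0 < e -> \forall n \near \oo, n.+1%:R^-1 < e :> R.
  by move=> e0; exact: (near_infty_natSinv_lt (PosNum e0)).
have [cX _|ncX] := pselect (compact [set: X]).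
  apply/One_has_winning_strategyP.
  exists (fun l => (Ck_ball (Ck0 X R) setT (size l).+1%:R^-1)^°).
  split=> [l|b bP]; first exact: ball_move.
  apply; move=> V /nbhs_CkP[L [e [_ e0 LV]]].
  apply: filterS (invS_lt e e0) => n ne; apply: LV => x _.
  apply: lt_trans ne; have := interior_subset (bP n); rewrite size_mkseq; exact.
move=> /(One_wins_subsequences _ _ _ (compact_movesI X)).
(* from a move recover its compact set, and select one of its members *)
have /choice[KV KVP] (a : set (set X)) : exists KV : set X * set X,
    compact_moves X a ->
    [/\ compact KV.1, a = proper_open_supersets KV.1 & a KV.2].
  have [[K [_ cK] <-]|] := pselect (compact_moves X a); last first.
    by exists (set0, set0).
  have [x Kx] : exists x, ~ K x.
    apply: contrapT => Kx; apply: ncX.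
    suff -> : [set: X] = K by [].
    apply/seteqP; split=> // x _; apply: contrapT => nKx; apply: Kx.
    by exists x.
  exists (K, ~` [set x]) => _; split=> //; split.
  - apply: closed_openC; apply: accessible_closed_set1.
    exact: hausdorff_accessible hX.
  - by move=> /seteqP[_ /(_ x I)]; exact.
  - by move=> y Ky /= yx; apply: Kx; rewrite -yx.
pose small n (g : Ck X R) := [set x | `|(g : X -> R) x| < n.+1%:R^-1].
pose resp n a g := if `[< a (small n g) >] then small n g else (KV a).2.
apply: (One_wins_G1_transfer _ _ _ _ _ _
  (fun n a => (Ck_ball (Ck0 X R) (KV a).1 n.+1%:R^-1)^°) resp).
- by move=> n a /KVP[cK _ _]; exact: ball_move.
- move=> n a g /KVP[_ _ aV] _; rewrite /resp; case: asboolP => //.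
- move=> a b ab; apply: contraPP => nW; rewrite notK.
  move=> V /nbhs_CkP[L [e [cL e0 LV]]].
  have : \forall n \near \oo, L `<=` resp n (a n) (b n).
    apply: eventually_of_subsequences => phi phi_lt.
    apply: contrapT => nL; apply: nW; exists phi => // -[_ kc].
    by have [_ [n _ <-] Ln] := kc L cL; apply: nL; exists n.
  apply: filterS2 (invS_lt e e0) => n ne Ln; apply: LV => x /Ln.
  rewrite sub0r normrN => xn; apply: lt_trans ne; move: xn.
  rewrite /resp; case: asboolP => // nsmall _.
  have [/KVP[cK aE aV] abn] := ab n.
  suff smallT : small n (b n) = setT.
    by have : small n (b n) x by rewrite smallT.
  apply: contrapT => nT; apply: nsmall; rewrite aE; split=> //.
    apply: (@open_comp _ _ (fun x => `|(b n : X -> R) x|) [set y | y < _]).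
      by move=> y _; apply: cvg_norm; exact: cts_fun.
    exact: open_lt.
  move=> y Ky; have := interior_subset abn y Ky.
  by rewrite sub0r normrN.
Qed.

(** The answers are made to cluster at 0 without being 0, so their set is not
    closed. *)
Lemma One_clustering_not_closed_discrete : [set: X] !=set0 ->
  One_has_winning_strategy
    (G1 (open_nbhs (Ck0 X R)) (~` by_range (clustering_at (Ck0 X R)))) ->
  One_has_winning_strategy
    (G1 (nonempty_opens (Ck X R)) (by_range (closed_discrete_sets (Ck X R)))).
Proof.
move=> X0; apply: (One_wins_G1_transfer _ _ _ _ _ _
  (fun _ U => U `&` [set f | f <> Ck0 X R]) (fun _ _ f => f)).
- move=> _ U [oU U0]; split; first exact: openI oU (open_Ck_neq R X _).
  have [|f Uf f0] := Ck0_not_isolated R X U X0; first exact: open_nbhs_nbhs.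
  by exists f.
- by move=> _ U f _ [].
- move=> U f Uf [cl _] cl0.
  by have [n _ fn] := cl _ cl0; have [_ []] := Uf n.
Qed.

(** The answer [U] to a compact set is translated, in round [n], to a function
    that has the values imposed on the compact set and is equal to n+1 off [U].
    A compact set contained in no answer makes these functions escape. *)
Lemma One_opens_k_cover (W : set (nat -> Ck X R)) :
  [set: X] !=set0 -> completely_regular_space X ->
  (forall K (f : nat -> Ck X R), compact K ->
    (forall n, exists2 x, K x & (f n : X -> R) x = n.+1%:R) -> W f) ->
  One_has_winning_strategy (G1 (nonempty_opens (Ck X R)) W) ->
  One_has_winning_strategy (G1 (compact_moves X) (~` by_range (k_covers X))).
Proof.
move=> X0 crX Wesc.
(* [B a] is a function and a compact set on which agreement with it suffices
   for membership in [a] *)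
have /choice[B BP] (a : set (Ck X R)) : exists B : Ck X R * set X,
    nonempty_opens (Ck X R) a -> compacts X B.2 /\
      forall g : Ck X R, {in B.2, (g : X -> R) =1 (B.1 : X -> R)} -> a g.
  have [[oa [f af]]|] := pselect (nonempty_opens (Ck X R) a); last first.
    by exists (Ck0 X R, set0).
  have /nbhs_CkP[K [e [cK e0 Ka]]] : nbhs f a by exact: open_nbhs_nbhs.
  have [x _] := X0; exists (f, K `|` [set x]) => _; split.
    split; first by exists x; right.
    by apply: compactU => //; exact: compact_set1.
  move=> g gf; apply: Ka => y Ky.
  by rewrite gf ?subrr ?normr0//; apply/mem_set; left.
have /choice[resp respP] (p : nat * set (Ck X R) * set X) :
    exists g : Ck X R, proper_open_supersets (B p.1.2).2 p.2 ->
      compact (B p.1.2).2 ->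
      {in (B p.1.2).2, (g : X -> R) =1 ((B p.1.2).1 : X -> R)} /\
      forall x, ~ p.2 x -> (g : X -> R) x = p.1.1.+1%:R.
  case: p => [[n a] U] /=; case: (B a) => f K /=.
  have [[oU _ KU]|] := pselect (proper_open_supersets K U); last first.
    by exists (Ck0 X R).
  have [cK|] := pselect (compact K); last by exists (Ck0 X R).
  have [h [ch hK hU]] := compact_closed_separation R X K U crX cK oU KU.
  pose g x := (f : X -> R) x * h x + n.+1%:R * (1 - h x).
  have cg : continuous g.
    move=> x; apply: cvgD; apply: cvgM.
    - exact: cts_fun.
    - exact: ch.
    - exact: cvg_cst.
    - by apply: cvgB; [exact: cvg_cst | exact: ch].
  exists (mkcts cg : continuousType X R) => _ _; split=> [x /set_mem Kx|x Ux].
    by rewrite /= /mkcts /g hK// subrr mulr0 addr0 mulr1.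
  by rewrite /= /mkcts /g hU// mulr0 add0r subr0 mulr1.
apply: (One_wins_G1_transfer _ _ _ _ _ _
  (fun _ a => proper_open_supersets (B a).2) (fun n a U => resp (n, a, U))).
- by move=> _ a /BP[cB _]; exists (B a).2.
- move=> n a U /BP[[_ cB] Ba] BU; apply: Ba.
  by have [] := respP (n, a, U) BU cB.
- move=> a U aU nU.
  have [K cK KU] : exists2 K, compact K & forall n, ~ K `<=` U n.
    apply: contrapT => nK; apply: nU; apply: k_coversI.
    + by move=> _ [n _ <-]; have [_ []] := aU n.
    + by move=> [n _ Un]; have [_ []] := aU n.
    + move=> K cK; apply: contrapT => nV; apply: nK; exists K => // n KU.
      by apply: nV; exists (U n).
  apply: (Wesc K) => // n.
  have [x Kx Ux] : exists2 x, K x & ~ U n x.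
    apply: contrapT => nx; apply: (KU n) => x Kx; apply: contrapT => Ux.
    by apply: nx; exists x.
  exists x => //; have [/BP[[_ cB] _] BU] := aU n.
  by have [_ /(_ x Ux)] := respP (n, a n, U n) BU cB.
Qed.

End translations.

Theorem theorem41 (R : realType) (X : topologicalType)
  (X_nonempty : [set: X] !=set0) (X_tychonoff : tychonoff_space X) :
  [<->
    (* a *) One_has_winning_strategy
              (G1 (compact_moves X) (~` by_range (k_covers X)));
    (* b *) One_has_winning_strategy
              (G1 (open_nbhs (Ck0 X R)) (~` converging_to (Ck0 X R)));
    (* c *) One_has_winning_strategy
              (G1 (open_nbhs (Ck0 X R)) (~` by_range (clustering_at (Ck0 X R))));
    (* d *) One_has_winning_strategy
              (G1 (nonempty_opens (Ck X R))
                  (by_range (closed_discrete_sets (Ck X R))));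
    (* e *) Two_has_winning_strategy
              (G1 (k_covers X) (by_range (k_covers X)));
    (* f *) Two_has_winning_strategy
              (G1 (clustering_at (Ck0 X R)) (by_range (clustering_at (Ck0 X R))));
    (* g *) Two_has_winning_strategy
              (G1 (dense_sets (Ck X R)) (by_range (clustering_at (Ck0 X R))))].
Proof.
have ab := One_k_cover_converging R X X_tychonoff.1.
have bc := One_converging_clustering (Ck X R) (Ck0 X R).
have cd := One_clustering_not_closed_discrete R X X_nonempty.
have da : One_has_winning_strategy (G1 (nonempty_opens (Ck X R))
      (by_range (closed_discrete_sets (Ck X R)))) ->
    One_has_winning_strategy (G1 (compact_moves X) (~` by_range (k_covers X))).
  apply: One_opens_k_cover X_tychonoff.2 _ => // K f cK fK.
  exact: escaping_closed_discrete cK fK.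
have ga : One_has_winning_strategy (G1 (nonempty_opens (Ck X R))
      (~` by_range (clustering_at (Ck0 X R)))) ->
    One_has_winning_strategy (G1 (compact_moves X) (~` by_range (k_covers X))).
  apply: One_opens_k_cover X_tychonoff.2 _ => // K f cK fK.
  exact: escaping_not_clustering cK fK.
have cg := One_nbhs_opens (Ck X R) (Ck0 X R).
have ea := k_covers_dual X X_nonempty.
have fc := clustering_dual (Ck X R) (Ck0 X R).
have gd := dense_dual (Ck X R) (Ck0 X R).
tfae=> //.
- by move=> /da/ea.
- by move=> /ea/ab/bc/fc.
- by move=> /fc/cg/gd.
- by move=> /gd/ga.
Qed.
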